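(* Let $q(x^{(1)},x^{(2)},y^{(1)},y^{(2)})$ be a joint distribution on finite sets such that $X^{(1)}=X^{(2)}$ almost surely, and write $X=X^{(1)}=X^{(2)}$. Let $r\ge1$ and let random variables $F_1,\dots,F_r$ (on finite alphabets) be jointly distributed with $(X,Y^{(1)},Y^{(2)})$ (whose joint law is the one induced by $q$) such that $Y^{(1)}-F_rF_{r-1}\cdots F_1X-Y^{(2)}$. Suppose positive reals $R'_1,\dots,R'_r$ satisfy $\sum_{i=1}^s R'_i> I(Y^{(1)}Y^{(2)};F_1\cdots F_s\mid X)$ for every $1\le s\le r$. Then the rate pair $\big(\sum_{i\text{ odd}}R'_i,\ \sum_{i\text{ even}}R'_i\big)$ is admissible for $q$ with two rounds of communication, i.e. with $r=2$ in the definition of admissibility.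
   Context: Two-node coordination problem. Fix finite alphabets and a joint pmf $q(x^{(1)},x^{(2)},y^{(1)},y^{(2)})$. For a natural number $r$, a code of blocklength $n$ with $r$ interactive rounds is as follows: node 1 observes $X^{(1)}_{1:n}$ and node 2 observes $X^{(2)}_{1:n}$, where $(X^{(1)}_i,X^{(2)}_i)_{i=1}^n$ are i.i.d. with the $(X^{(1)},X^{(2)})$-marginal of $q$; node 1 has private randomness $M_1$ and node 2 private randomness $M_2$, with $M_1$, $M_2$, $(X^{(1)}_{1:n},X^{(2)}_{1:n})$ mutually independent; there is no common randomness. Messages $C_1,\dots,C_r$ are sent, with $H(C_i\mid C_{1:i-1}X^{(1)}_{1:n}M_1)=0$ for odd $i$ and $H(C_i\mid C_{1:i-1}X^{(2)}_{1:n}M_2)=0$ for even $i$, and $\frac1n\sum_{i\text{ odd}}H(C_i)\le R_{12}$, $\frac1n\sum_{i\text{ even}}H(C_i)\le R_{21}$. Afterwards node 1 produces $\widehat Y^{(1)}_{1:n}$ as a function of $(X^{(1)}_{1:n},M_1,C_{1:r})$ and node 2 produces $\widehat Y^{(2)}_{1:n}$ as a function of $(X^{(2)}_{1:n},M_2,C_{1:r})$. The pair $(R_{12},R_{21})$ is admissible for $q$ with $r$ rounds if for every $\epsilon>0$ there is $n_0$ such that for all $n\ge n_0$ such a code exists for which the total variation ($\ell_1$) distance between the law of $(X^{(1)}_{1:n},X^{(2)}_{1:n},\widehat Y^{(1)}_{1:n},\widehat Y^{(2)}_{1:n})$ and the law of $n$ i.i.d. copies of $(X^{(1)},X^{(2)},Y^{(1)},Y^{(2)})\sim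 q$ is at most $\epsilon$. The notation $A-B-C$ means $A$ and $C$ are conditionally independent given $B$; juxtaposition denotes joint random variables. *)

(* Defs.v *)
From HB Require Import structures.
From mathcomp Require Import all_boot all_order all_algebra.
From mathcomp Require Import all_classical all_reals all_analysis.
Set Implicit Arguments. Unset Strict Implicit. Unset Printing Implicit Defensive.
Import Order.TTheory GRing.Theory Num.Theory.
Local Open Scope ring_scope.

Section FiniteProbability.
Variable R : realType.

Definition is_pmf (T : finType) (p : {ffun T -> R}) : Prop :=
  (forall t, 0 <= p t) /\ \sum_t p t = 1.

Definition dlaw (Om T : finType) (P : {ffun Om -> R}) (X : Om -> T) : {ffun T -> R} :=
  [ffun t => \sum_(w | X w == t) P w].

(** Shannon entropy (natural logarithm; the base is irrelevant for the
    statement since rates and information quantities use the same one).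
    Note [0 * ln 0 = 0]. *)
Definition entropy (T : finType) (p : {ffun T -> R}) : R :=
  - \sum_t p t * ln (p t).

Definition Hrv (Om T : finType) (P : {ffun Om -> R}) (X : Om -> T) : R :=
  entropy (dlaw P X).

Definition cmi (Om TX TY TZ : finType) (P : {ffun Om -> R})
    (X : Om -> TX) (Y : Om -> TY) (Z : Om -> TZ) : R :=
  Hrv P (fun w => (X w, Z w)) + Hrv P (fun w => (Y w, Z w))
  - Hrv P (fun w => (X w, Y w, Z w)) - Hrv P Z.

Definition markov_chain (Om TX TY TZ : finType) (P : {ffun Om -> R})
    (X : Om -> TX) (Z : Om -> TZ) (Y : Om -> TY) : Prop :=
  forall x y z,
    dlaw P (fun w => (X w, Y w, Z w)) (x, y, z) * dlaw P Z z =
    dlaw P (fun w => (X w, Z w)) (x, z) * dlaw P (fun w => (Y w, Z w)) (y, z).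

Definition l1dist (T : finType) (p p' : {ffun T -> R}) : R :=
  \sum_t `|p t - p' t|.

End FiniteProbability.

Section Coordination.
Variable R : realType.
Variables (A1 A2 B1 B2 : finType).
Variable q : {ffun A1 * A2 * B1 * B2 -> R}.

Definition qX (a1 : A1) (a2 : A2) : R := \sum_(y1 : B1) \sum_(y2 : B2) q (a1, a2, y1, y2).

Definition iid_q (n : nat) :
    {ffun {ffun 'I_n -> A1} * {ffun 'I_n -> A2} * {ffun 'I_n -> B1} * {ffun 'I_n -> B2} -> R} :=
  [ffun z : {ffun 'I_n -> A1} * {ffun 'I_n -> A2} * {ffun 'I_n -> B1} * {ffun 'I_n -> B2} => \prod_(i < n) q (z.1.1.1 i, z.1.1.2 i, z.1.2 i, z.2 i)].

Definition code_space (n : nat) (M1 M2 : finType) (pM1 : {ffun M1 -> R}) (pM2 : {ffun M2 -> R}) :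
    {ffun {ffun 'I_n -> A1} * {ffun 'I_n -> A2} * M1 * M2 -> R} :=
  [ffun w : {ffun 'I_n -> A1} * {ffun 'I_n -> A2} * M1 * M2 => (\prod_(i < n) qX (w.1.1.1 i) (w.1.1.2 i)) * pM1 w.1.2 * pM2 w.2].

Definition code2_exists (n : nat) (R12 R21 eps : R) : Prop :=
  exists (M1 M2 C1 C2 : finType) (pM1 : {ffun M1 -> R}) (pM2 : {ffun M2 -> R})
    (e1 : {ffun 'I_n -> A1} -> M1 -> C1)
    (e2 : C1 -> {ffun 'I_n -> A2} -> M2 -> C2)
    (d1 : {ffun 'I_n -> A1} -> M1 -> C1 -> C2 -> {ffun 'I_n -> B1})
    (d2 : {ffun 'I_n -> A2} -> M2 -> C1 -> C2 -> {ffun 'I_n -> B2}),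
    is_pmf pM1 /\ is_pmf pM2 /\
    let P := code_space n pM1 pM2 in
    let c1 := fun w : {ffun 'I_n -> A1} * {ffun 'I_n -> A2} * M1 * M2 =>
                e1 w.1.1.1 w.1.2 in
    let c2 := fun w : {ffun 'I_n -> A1} * {ffun 'I_n -> A2} * M1 * M2 =>
                e2 (c1 w) w.1.1.2 w.2 in
    let out := fun w : {ffun 'I_n -> A1} * {ffun 'I_n -> A2} * M1 * M2 =>
                (w.1.1.1, w.1.1.2,
                 d1 w.1.1.1 w.1.2 (c1 w) (c2 w),
                 d2 w.1.1.2 w.2 (c1 w) (c2 w)) in
    [/\ Hrv P c1 / n%:R <= R12,
        Hrv P c2 / n%:R <= R21 &
        l1dist (dlaw P out) (iid_q n) <= eps].

Definition admissible2 (R12 R21 : R) : Prop :=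
  forall eps : R, 0 < eps -> exists n0 : nat, forall n : nat, (n0 <= n)%N ->
    code2_exists n R12 R21 eps.

End Coordination.

(* Main.v *)
Require Import Defs.
From HB Require Import structures.
From mathcomp Require Import all_boot all_order all_algebra.
From mathcomp Require Import all_classical all_reals all_analysis.
From mathcomp Require Import ring lra.
Set Implicit Arguments. Unset Strict Implicit. Unset Printing Implicit Defensive.
Import Order.TTheory GRing.Theory Num.Theory numFieldNormedType.Exports.
Local Open Scope ring_scope.

(** Since both nodes see [X], they only need common randomness, and only the
    constraint [s = r] matters. Write [F = (F_1, ..., F_r)]. Node 1 and node 2
    send independent uniform messages of rates [R12] and [R21]; the pair
    indexes a codebook of sequences [F^n] that depends on [x^n], and each node
    then draws its output locally from [p(y_k | f, x)], which is legitimate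
    because of the Markov chain [Y1 - F X - Y2]. As
    [R12 + R21 > I(Y1 Y2; F | X)], the soft covering lemma applied to each
    [x^n] yields a codebook whose output law is close to [p(y1, y2 | x)^n] on
    average over [x^n]. *)

(** A single law [Q] is treated as the constant family [fun _ : I => Q]; its normalization can then
    be read off only when the index type is inhabited. *)
Definition stochastic (R : realType) (S T : finType) (K : S -> T -> R) : Prop :=
  (forall s t, 0 <= K s t) /\ (forall s, \sum_t K s t = 1).

(** * Moments under product measures *)

Section ProductMeasures.
Variable R : realType.

Lemma sum_ffun_prod (I T : finType) (F : I -> T -> R) :
  \sum_(m : {ffun I -> T}) \prod_i F i (m i) = \prod_i \sum_t F i t.
Proof. by rewrite bigA_distr_bigA. Qed.

Lemma sum_ffun_prod1 (I T : finType) (K : I -> T -> R) :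
  stochastic K -> \sum_(m : {ffun I -> T}) \prod_i K i (m i) = 1.
Proof. by case=> _ K1; rewrite sum_ffun_prod big1. Qed.

(** Inserting the factor 1 at every coordinate other than [s] turns the integrand into a product, so
    the sum distributes and the other coordinates integrate to 1. *)
Lemma expect_coord (I T : finType) (K : I -> T -> R) (s : I) (h : T -> R) :
  stochastic K ->
  \sum_(m : {ffun I -> T}) (\prod_i K i (m i)) * h (m s) = \sum_t K s t * h t.
Proof.
case=> _ K1.
under eq_bigr => m _.
  have -> : (\prod_i K i (m i)) * h (m s)
     = \prod_i (K i (m i) * (if i == s then h (m i) else 1)).
    by rewrite big_split /= -big_mkcond /= big_pred1_eq.
  over.
rewrite (sum_ffun_prod (fun i t => K i t * (if i == s then h t else 1))).
rewrite (bigD1 s) //= eqxx [X in _ * X]big1 ?mulr1 // => i /negbTE ->.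
by under eq_bigr do rewrite mulr1.
Qed.

Lemma expect_coord2 (I T : finType) (K : I -> T -> R) (s s' : I) (h : T -> R) :
  stochastic K -> s != s' ->
  \sum_(m : {ffun I -> T}) (\prod_i K i (m i)) * (h (m s) * h (m s'))
  = (\sum_t K s t * h t) * (\sum_t K s' t * h t).
Proof.
case=> _ K1 ss'.
under eq_bigr => m _.
  have -> : (\prod_i K i (m i)) * (h (m s) * h (m s'))
     = \prod_i (K i (m i) * ((if i == s then h (m i) else 1)
                            * (if i == s' then h (m i) else 1))).
    by rewrite big_split big_split /= -!big_mkcond /= !big_pred1_eq.
  over.
rewrite (sum_ffun_prod (fun i t =>
  K i t * ((if i == s then h t else 1) * (if i == s' then h t else 1)))).
have s's : s' != s by rewrite eq_sym.
rewrite (bigD1 s) //= (bigD1 s') //= !eqxx (negbTE ss') (negbTE s's).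
rewrite [X in _ * (_ * X)]big1 ?mulr1 => [|i /andP[/negbTE -> /negbTE ->]].
  by congr (_ * _); apply: eq_bigr => t _; rewrite ?mulr1 ?mul1r.
by under eq_bigr do rewrite !mulr1.
Qed.

(** Variance of a sum of centered i.i.d. terms: the cross terms vanish by independence of distinct
    coordinates. *)
Lemma expect_sqr_sum (I T : finType) (Q : T -> R) (h : T -> R) :
  stochastic (fun _ : I => Q) -> \sum_t Q t * h t = 0 ->
  \sum_(m : {ffun I -> T}) (\prod_i Q (m i)) * (\sum_i h (m i)) ^+ 2
  = #|I|%:R * \sum_t Q t * h t ^+ 2.
Proof.
move=> Qs h0.
have sqrE (m : {ffun I -> T}) : (\prod_i Q (m i)) * (\sum_i h (m i)) ^+ 2
    = \sum_i \sum_j (\prod_i Q (m i)) * (h (m i) * h (m j)).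
  rewrite expr2 mulr_suml mulr_sumr; apply: eq_bigr => i _.
  by rewrite -mulr_sumr -mulr_sumr.
under eq_bigr do rewrite sqrE.
rewrite exchange_big /= -sum1_card natr_sum mulr_suml; apply: eq_bigr => i _.
rewrite exchange_big /= (bigD1 i) //= mul1r [X in _ + X]big1 ?addr0 => [|j ji].
  rewrite (expect_coord i (fun t => h t * h t) Qs).
  by apply: eq_bigr => t _; rewrite expr2.
by rewrite (expect_coord2 h Qs) 1?eq_sym // h0 mul0r.
Qed.

(** The random coding argument: were every value above [b], a point of positive mass would make the
    mean strictly larger than [b]. *)
Lemma expect_le_exists (T : finType) (Q G : T -> R) (b : R) :
  (forall t, 0 <= Q t) -> \sum_t Q t = 1 -> \sum_t Q t * G t <= b ->
  exists t, G t <= b.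
Proof.
move=> Q0 Q1 Gb; apply: contrapT => /forallNP nG.
have bG t : b < G t by rewrite ltNge; apply/negP/nG.
have [t Qt] : exists t, 0 < Q t.
  apply: contrapT => /forallNP nQ; move: Q1; rewrite big1 => [/eqP|t _].
    by rewrite eq_sym oner_eq0.
  by apply/eqP; rewrite eq_le Q0 andbT leNgt; apply/negP/nQ.
suff : b < \sum_t Q t * G t by rewrite ltNge Gb.
rewrite -[b]mul1r -Q1 mulr_suml (bigD1 t) //= [X in _ < X](bigD1 t) //=.
apply: ltr_leD; first by rewrite ltr_pM2l.
by apply: ler_sum => s _; rewrite ler_wpM2l // ltW.
Qed.

End ProductMeasures.

(** * One-shot soft covering by a random codebook *)

(* [tau] truncates the likelihood ratio [W t y / V y]: a variance bound is
   used on the part of [W] below the threshold, the triangle inequality above. *)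
Section SoftCovering.
Variables (R : realType) (I T Y : finType) (Q : T -> R) (W : T -> Y -> R).
Variables (tau sigma : R).
Hypotheses (Qs : stochastic (fun _ : I => Q)) (Q0 : forall t, 0 <= Q t)
  (Ws : stochastic W) (Icard : (0 < #|I|)%N)
  (tau0 : 0 <= tau) (sigma0 : 0 < sigma)
  (tau_sigma : tau / #|I|%:R <= sigma ^+ 2).

(** [V] is the target output law. The suffixes [g] and [b] mark the good part of [W], at or below
    the threshold [tau * V y], and the bad part above it. [avg g c] is the average of [g] over the
    codebook [c]. *)
Let V y := \sum_t Q t * W t y.
Let Wg t y := if tau * V y < W t y then 0 else W t y.
Let Wb t y := if tau * V y < W t y then W t y else 0.
Let Vg y := \sum_t Q t * Wg t y.
Let Vb y := \sum_t Q t * Wb t y.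
Let L : R := #|I|%:R.
Let avg (g : T -> R) (c : {ffun I -> T}) : R := L^-1 * \sum_i g (c i).

Let W0 t y : 0 <= W t y. Proof. by case: Ws. Qed.
Let Wg0 t y : 0 <= Wg t y. Proof. by rewrite /Wg; case: ifP. Qed.
Let Wb0 t y : 0 <= Wb t y. Proof. by rewrite /Wb; case: ifP. Qed.
Let L0 : 0 < L. Proof. by rewrite ltr0n. Qed.
Let WE t y : W t y = Wg t y + Wb t y.
Proof. by rewrite /Wg /Wb; case: ifP; rewrite ?addr0 ?add0r. Qed.
Let V0 y : 0 <= V y. Proof. by apply: sumr_ge0 => t _; rewrite mulr_ge0. Qed.
Let Vb0 y : 0 <= Vb y. Proof. by apply: sumr_ge0 => t _; rewrite mulr_ge0. Qed.
Let Pc (c : {ffun I -> T}) := \prod_i Q (c i).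
Let Pc0 c : 0 <= Pc c. Proof. exact: prodr_ge0. Qed.

Let Qsum : \sum_t Q t = 1.
Proof. by case: Qs => _ Q1; case/card_gt0P: Icard => i _; exact: Q1 i. Qed.

Let expect_avg g : \sum_c Pc c * avg g c = \sum_t Q t * g t.
Proof.
under eq_bigr => c _ do rewrite /avg mulrCA mulr_sumr.
rewrite -mulr_sumr exchange_big /=.
under eq_bigr => i _ do rewrite (expect_coord i g Qs).
by rewrite sumr_const -mulr_natl mulrA mulVf ?mul1r // gt_eqF.
Qed.

(** The mean absolute deviation is controlled by the variance of the codebook average, which is at
    most [(tau / L) * V y ^+ 2], hence at most the square of [sigma * V y]. *)
Let good_expect y : \sum_c Pc c * `|avg (Wg^~ y) c - Vg y| <= sigma * V y.
Proof.
(* A null output is treated apart, since [u] below becomes a divisor. There the threshold is 0 and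
   the truncation leaves nothing. *)
have [Vy0|Vyn0] := eqVneq (V y) 0.
  have Wg_0 t : Wg t y = 0.
    apply/eqP; rewrite eq_le Wg0 andbT /Wg Vy0 mulr0; case: ifPn => //.
    by rewrite -leNgt.
  have Vg_0 : Vg y = 0 by rewrite /Vg big1 // => t _; rewrite Wg_0 mulr0.
  rewrite Vy0 mulr0 big1 // => c _.
  by rewrite /avg Vg_0 big1 ?mulr0 ?subr0 ?normr0 ?mulr0.
have Vp : 0 < V y by rewrite lt_def Vyn0 V0.
pose u := sigma * V y.
have u0 : 0 < u by rewrite mulr_gt0.
pose h t := Wg t y - Vg y.
have h0 : \sum_t Q t * h t = 0.
  under eq_bigr do rewrite mulrBr.
  by rewrite big_split /= sumrN -mulr_suml Qsum mul1r subrr.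
have avgE c : avg (Wg^~ y) c - Vg y = L^-1 * \sum_i h (c i).
  rewrite /avg /h big_split /= sumrN sumr_const -mulr_natl mulrBr mulrA.
  by rewrite mulVf ?mul1r // gt_eqF.
have var : \sum_c Pc c * (avg (Wg^~ y) c - Vg y) ^+ 2 <= u ^+ 2.
  under eq_bigr do rewrite avgE exprMn mulrCA.
  rewrite -mulr_sumr (expect_sqr_sum Qs h0).
  have LL : L^-1 ^+ 2 * L = L^-1 by field; exact: lt0r_neq0.
  rewrite mulrA LL.
  (* The square of the mean is dropped; in the remaining second moment one factor is bounded by the
     threshold, and the other averages to at most [V y]. *)
  have h2 : \sum_t Q t * h t ^+ 2 <= tau * V y * V y.
    have -> : \sum_t Q t * h t ^+ 2
       = \sum_t Q t * Wg t y ^+ 2 - Vg y ^+ 2.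
      have e v : \sum_t Q t * (Wg t y - v) ^+ 2 = \sum_t (Q t * Wg t y ^+ 2)
         - 2 * v * \sum_t (Q t * Wg t y) + v ^+ 2 * \sum_t Q t.
        rewrite !mulr_sumr -sumrN -!big_split /=; apply: eq_bigr => t _.
        by ring.
      by rewrite e Qsum -[\sum_t Q t * Wg t y]/(Vg y) mulr1 expr2; ring.
    rewrite lerBlDr ler_wpDr ?sqr_ge0 //.
    have -> : tau * V y * V y = \sum_t Q t * (tau * V y * W t y).
      by rewrite [in RHS](eq_bigr _ (fun t _ => mulrCA _ _ _)) -mulr_sumr.
    apply: ler_sum => t _; rewrite ler_wpM2l // expr2 /Wg; case: ifPn => H.
      by rewrite mul0r !mulr_ge0.
    by rewrite ler_wpM2r // leNgt.
  apply: (@le_trans _ _ (L^-1 * (tau * V y * V y))).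
    by rewrite ler_wpM2l // invr_ge0 ltW.
  have -> : L^-1 * (tau * V y * V y) = (tau / L) * V y ^+ 2.
    by move: (V y) => v; ring.
  by rewrite /u exprMn ler_wpM2r ?sqr_ge0.
(* [2 |a| <= a^2 / u + u] *)
have absle (a : R) : `|a| <= (a ^+ 2 / u + u) / 2.
  have -> : (a ^+ 2 / u + u) / 2 = `|a| + (`|a| - u) ^+ 2 / (2 * u).
    rewrite -(real_normK (num_real a)); field; exact: lt0r_neq0.
  by rewrite lerDl divr_ge0 ?sqr_ge0 // mulr_ge0 // ltW.
apply: (@le_trans _ _ (\sum_c Pc c * (((avg (Wg^~ y) c - Vg y) ^+ 2 / u + u) / 2))).
  by apply: ler_sum => c _; rewrite ler_wpM2l.
have -> : \sum_c Pc c * (((avg (Wg^~ y) c - Vg y) ^+ 2 / u + u) / 2) =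
  ((\sum_c Pc c * (avg (Wg^~ y) c - Vg y) ^+ 2) / u + (\sum_c Pc c) * u) / 2.
  rewrite !mulr_suml -big_split /= mulr_suml; apply: eq_bigr => c _.
  by ring.
rewrite (sum_ffun_prod1 Qs) mul1r ler_pdivrMr //.
have : (\sum_c Pc c * (avg (Wg^~ y) c - Vg y) ^+ 2) / u <= u.
  by rewrite ler_pdivrMr // -expr2.
rewrite -/u; lra.
Qed.

(** The bound is proved in expectation over an i.i.d. codebook. The bad parts of the codebook output
    and of the target have the same expected mass, hence the factor 2; the good parts contribute
    [sigma]. *)
Lemma soft_covering :
  exists c : {ffun I -> T},
    \sum_y `|#|I|%:R^-1 * (\sum_i W (c i) y) - \sum_t Q t * W t y|
    <= 2 * (\sum_t \sum_y Q t *
             (if tau * (\sum_t' Q t' * W t' y) < W t y then W t y else 0))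
       + sigma.
Proof.
apply: (@expect_le_exists _ _ Pc) => //; first exact: (sum_ffun_prod1 Qs).
have step (c : {ffun I -> T}) : \sum_y `|L^-1 * (\sum_i W (c i) y) - V y| <=
   \sum_y `|avg (Wg^~ y) c - Vg y| + \sum_y (avg (Wb^~ y) c + Vb y).
  rewrite -big_split /=; apply: ler_sum => y _.
  have -> : L^-1 * (\sum_i W (c i) y) - V y =
     (avg (Wg^~ y) c - Vg y) + (avg (Wb^~ y) c - Vb y).
    have -> : V y = Vg y + Vb y.
      rewrite /V /Vg /Vb -big_split /=; apply: eq_bigr => t _.
      by rewrite WE mulrDr.
    have -> : \sum_i W (c i) y = \sum_i Wg (c i) y + \sum_i Wb (c i) y.
      by rewrite -big_split /=; apply: eq_bigr => i _; rewrite WE.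
    by rewrite /avg; ring.
  apply: (le_trans (ler_normD _ _)); rewrite lerD2l.
  have a0 : 0 <= avg (Wb^~ y) c.
    by rewrite mulr_ge0 ?invr_ge0 ?(ltW L0) // sumr_ge0.
  by rewrite (le_trans (ler_normB _ _)) // !ger0_norm.
apply: (@le_trans _ _ (\sum_c Pc c *
  (\sum_y `|avg (Wg^~ y) c - Vg y| + \sum_y (avg (Wb^~ y) c + Vb y)))).
  by apply: ler_sum => c _; rewrite ler_wpM2l.
under eq_bigr do rewrite mulrDr !mulr_sumr.
rewrite big_split /= addrC; apply: lerD.
  rewrite exchange_big [X in _ <= 2 * X]exchange_big /= mulr_sumr.
  apply: ler_sum => y _; under eq_bigr do rewrite mulrDr.
  rewrite big_split /= -mulr_suml (sum_ffun_prod1 Qs) mul1r expect_avg.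
  by rewrite -[leRHS]/(2 * Vb y) -[X in X + _]/(Vb y) mulr_natl mulr2n.
rewrite exchange_big /=.
apply: (@le_trans _ _ (\sum_y sigma * V y)); first exact: ler_sum.
rewrite -mulr_sumr /V exchange_big /=.
under eq_bigr do rewrite -mulr_sumr (proj2 Ws) mulr1.
by rewrite Qsum mulr1.
Qed.

End SoftCovering.

(** * Laws, entropies and conditional kernels on finite spaces *)

Section Laws.
Variable R : realType.

Lemma dlaw_pmf (Om T : finType) (P : {ffun Om -> R}) (X : Om -> T) :
  is_pmf P -> is_pmf (dlaw P X).
Proof.
case=> P0 P1; split=> [t|]; first by rewrite ffunE sumr_ge0.
under eq_bigr do rewrite ffunE.
by rewrite -P1 [RHS](partition_big X xpredT).
Qed.

Lemma ler_dlaw (Om T : finType) (P : {ffun Om -> R}) (X : Om -> T) w :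
  (forall w, 0 <= P w) -> P w <= dlaw P X (X w).
Proof.
by move=> P0; rewrite ffunE (bigD1 w) //= lerDl sumr_ge0.
Qed.

Lemma dlaw_marginal (Om T U : finType) (P : {ffun Om -> R})
    (X : Om -> T) (Z : Om -> U) z :
  \sum_x dlaw P (fun w => (X w, Z w)) (x, z) = dlaw P Z z.
Proof.
rewrite ffunE [RHS](partition_big X xpredT) //=.
by apply: eq_bigr => x _; rewrite ffunE; apply: eq_bigl => w; rewrite xpair_eqE andbC.
Qed.

Lemma dlaw_reindex (Om T U : finType) (P : {ffun Om -> R})
    (X : Om -> T) (Z : Om -> U) t u :
  (forall w, (X w == t) = (Z w == u)) -> dlaw P X t = dlaw P Z u.
Proof. by move=> XZ; rewrite !ffunE; apply: eq_bigl. Qed.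

(** Averaging over outcomes instead of values puts all entropies on one index set, so that those in
    a conditional mutual information combine outcome by outcome. *)
Lemma HrvE (Om T : finType) (P : {ffun Om -> R}) (X : Om -> T) :
  Hrv P X = - \sum_w P w * ln (dlaw P X (X w)).
Proof.
rewrite /Hrv /entropy; congr (- _).
rewrite [RHS](partition_big X xpredT) //=; apply: eq_bigr => t _.
rewrite {1}ffunE mulr_suml; apply: eq_bigr => w /eqP <- //.
Qed.

Lemma cmiE (Om TX TY TZ : finType) (P : {ffun Om -> R})
    (X : Om -> TX) (Y : Om -> TY) (Z : Om -> TZ) :
  cmi P X Y Z = \sum_w P w *
    (ln (dlaw P (fun w => (X w, Y w, Z w)) (X w, Y w, Z w)) + ln (dlaw P Z (Z w))
     - ln (dlaw P (fun w => (X w, Z w)) (X w, Z w))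
     - ln (dlaw P (fun w => (Y w, Z w)) (Y w, Z w))).
Proof.
rewrite /cmi !HrvE !opprK -!sumrN -!big_split /=; apply: eq_bigr => w _.
by ring.
Qed.

(** Gibbs' inequality against the uniform law: [ln u <= u - 1] is applied at
    [u = 1 / (P t * #|T|)]. *)
Lemma entropy_le_ln_card (T : finType) (P : {ffun T -> R}) :
  is_pmf P -> entropy P <= ln #|T|%:R.
Proof.
case=> P0 P1.
have T0 : (0 < #|T|)%N.
  rewrite lt0n; apply/eqP => /card0_eq T0; move: P1.
  by rewrite big1 => [/eqP|t _]; [rewrite eq_sym oner_eq0 | have := T0 t].
have N0 : 0 < #|T|%:R :> R by rewrite ltr0n.
have lnE : ln #|T|%:R = \sum_t P t * ln #|T|%:R :> R by rewrite -mulr_suml P1 mul1r.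
rewrite -subr_le0 /entropy lnE -opprD -big_split /= -sumrN; apply: (@le_trans _ _ (\sum_t (#|T|%:R^-1 - P t))).
  apply: ler_sum => t _.
  have [->|Pt] := eqVneq (P t) 0; first by rewrite !(mul0r, addr0, oppr0) invr_ge0 ltW.
  have Pp : 0 < P t by rewrite lt_def Pt P0.
  have NP : 0 < P t * #|T|%:R by rewrite mulr_gt0.
  rewrite -mulrDr -lnM ?posrE // -mulrN -lnV ?posrE //.
  have := @le_ln1Dx R ((P t * #|T|%:R)^-1 - 1).
  rewrite ltrBDr addNr invr_gt0 NP => /(_ isT); rewrite addrC subrK => H.
  have := ler_wpM2l (P0 t) H; move/le_trans; apply.
  rewrite mulrBr mulr1 invfM mulrA mulfV // mul1r.
  exact: lexx.
rewrite big_split /= sumrN P1 sumr_const -(mulr_natl _ #|T|) divff ?subrr //.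
exact: lt0r_neq0.
Qed.

(** Conditioning by division. A row of total mass 0 has only zero entries, so any law factors it;
    the point mass at [t0] is the default. *)
Lemma conditional_kernel (S T : finType) (J : S -> T -> R) (t0 : T) :
  (forall s t, 0 <= J s t) ->
  exists K, stochastic K /\ forall s t, J s t = (\sum_t' J s t') * K s t.
Proof.
move=> J0.
exists (fun s t => if \sum_t' J s t' == 0 then (t == t0)%:R
                   else J s t / \sum_t' J s t').
split; last first.
  move=> s t; case: ifPn => [/eqP s0|sn0]; last by rewrite mulrCA divff ?mulr1.
  by rewrite s0 mul0r; apply: (psumr_eq0P _ s0).
split=> [s t|s]; first by case: ifPn => // _; rewrite divr_ge0 ?sumr_ge0.
case: (boolP (\sum_t' J s t' == 0)) => s0; last by rewrite -mulr_suml divff.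
by rewrite (bigD1 t0) //= eqxx big1 ?addr0 // => t /negbTE ->.
Qed.

End Laws.

(** * Exponential moments and geometric decay *)

Section Chernoff.
Variable R : realType.

(** Inverting [1 - u <= expR (- u)] reduces the claim to [(1 + u + 2 * u ^+ 2) * (1 - u) >= 1],
    whose slack is [u ^+ 2 * (1 - 2 * u)]. *)
Lemma expR_le_quadratic (u : R) : u <= 2^-1 -> expR u <= 1 + u + 2 * u ^+ 2.
Proof.
move=> u1.
have h1 : 0 < 1 - u by lra.
have h2 : 1 - u <= expR (- u) by exact: expR_ge1Dx.
have h3 : expR u <= (1 - u)^-1.
  by rewrite -[u in expR u]opprK expRN lef_pV2 ?posrE ?expR_gt0.
apply: (le_trans h3).
rewrite -[_^-1]mul1r ler_pdivrMr // -subr_ge0.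
have -> : (1 + u + 2 * u ^+ 2) * (1 - u) - 1 = u ^+ 2 * (1 - 2 * u) by ring.
by rewrite mulr_ge0 ?sqr_ge0 //; lra.
Qed.

(** At [l = 0] the moment equals 1 and has negative slope, the mean of [g] minus [a]; a small
    positive [l] therefore brings it below 1. *)
Lemma exp_moment_lt1 (T : finType) (P g : T -> R) (a : R) :
  (forall t, 0 <= P t) -> \sum_t P t = 1 -> \sum_t P t * g t < a ->
  exists2 l, 0 < l & \sum_t P t * expR (l * (g t - a)) < 1.
Proof.
move=> P0 P1 ga.
pose G : R := 1 + \sum_t `|g t - a|.
have S0 : 0 <= \sum_t `|g t - a| by exact: sumr_ge0.
have G0 : 0 < G by rewrite /G; lra.
have gG t : `|g t - a| <= G.
  rewrite /G (bigD1 t) //=.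
  have : 0 <= \sum_(i | i != t) `|g i - a| by exact: sumr_ge0.
  by move: (\sum_(i | i != t) _) `|g t - a| => x y ?; lra.
pose d := a - \sum_t P t * g t.
have d0 : 0 < d by rewrite /d subr_gt0.
have G20 : 0 < G ^+ 2 by rewrite exprn_gt0.
(* The first entry keeps exponents at most 1/2, as the quadratic bound requires; the second makes
   the quadratic term at most [l * d / 2], half of the linear gain. *)
pose l := Num.min (2^-1 / G) (4^-1 * d / G ^+ 2).
have l0 : 0 < l by rewrite /l lt_min !divr_gt0 ?mulr_gt0.
have lG : l * G <= 2^-1 by rewrite -ler_pdivlMr // /l ge_min lexx.
have lG2 : l * G ^+ 2 <= 4^-1 * d by rewrite -ler_pdivlMr // /l ge_min lexx orbT.
exists l => //.
apply: (@le_lt_trans _ _ (\sum_t P t * (1 + l * (g t - a) + 2 * (l * G) ^+ 2))).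
  apply: ler_sum => t _; apply: ler_wpM2l => //.
  have := gG t; rewrite ler_norml => /andP[g1 g2].
  apply: (le_trans (expR_le_quadratic _)).
    by apply: (le_trans _ lG); rewrite ler_wpM2l // ltW.
  rewrite lerD2l ler_wpM2l // -[leLHS]real_normK ?num_real //.
  rewrite lerXn2r ?nnegrE ?normr_ge0 ?mulr_ge0 ?(ltW l0) ?(ltW G0) //.
  by rewrite normrM (gtr0_norm l0) ler_wpM2l // ltW.
have -> : \sum_t P t * (1 + l * (g t - a) + 2 * (l * G) ^+ 2)
   = 1 - l * d + 2 * (l * G) ^+ 2.
  transitivity (\sum_t P t + l * (\sum_t P t * g t)
     - l * a * (\sum_t P t) + 2 * (l * G) ^+ 2 * \sum_t P t).
    rewrite !mulr_sumr -sumrN -!big_split /=; apply: eq_bigr => t _; ring.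
  by rewrite P1 /d; ring.
have : l * (l * G ^+ 2) <= l * (4^-1 * d) by rewrite ler_wpM2l // ltW.
have : 0 < l * d by rewrite mulr_gt0.
have -> : (l * G) ^+ 2 = l * (l * G ^+ 2) by rewrite exprMn [l ^+ 2]expr2 mulrA.
rewrite (mulrCA l 4^-1); move: (l * d) (l * (l * _)) => x y.
lra.
Qed.

Lemma pow_le_eventually (c e : R) : 0 <= c -> c < 1 -> 0 < e ->
  exists n0 : nat, forall n, (n0 <= n)%N -> c ^+ n <= e.
Proof.
move=> c0 c1 e0.
have H : (GRing.exp c @ \oo --> (0 : R))%classic.
  by apply: cvg_expr; rewrite ger0_norm.
have /cvgrPdist_le/(_ _ e0) [n0 _ Hn0] := H.
exists n0 => n n0n; have := Hn0 n n0n; rewrite /= sub0r normrN ger0_norm //.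
exact: exprn_ge0.
Qed.

End Chernoff.

(** * Sums over pairs and over pairs of sequences *)

Section PairSums.
Variable R : realType.

Lemma sum_pair (S T : finType) (F : S * T -> R) :
  \sum_w F w = \sum_s \sum_t F (s, t).
Proof. by rewrite pair_bigA; apply: eq_bigr => -[]. Qed.

Lemma sum_ffun_prod2 (I S T : finType) (F : S -> T -> R) :
  \sum_(s : {ffun I -> S}) \sum_(t : {ffun I -> T}) \prod_i F (s i) (t i)
  = \prod_(i : I) \sum_s \sum_t F s t.
Proof.
under [LHS]eq_bigr => s _ do rewrite (sum_ffun_prod (fun i => F (s i))).
by rewrite (sum_ffun_prod (fun _ s => \sum_t F s t)).
Qed.

End PairSums.

(** * Local randomization by private noise *)

(* A node's private randomness is a uniform message together with a
   presampled output for every possible input of its output kernel [K]. *)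
Section PrivateSampling.
Variables (R : realType) (X C Y : finType) (K : X -> Y -> R).
Hypotheses (Ks : stochastic K) (C0 : (0 < #|C|)%N).

Definition msg_noise : {ffun C * {ffun X -> Y} -> R} :=
  [ffun m : C * {ffun X -> Y} => #|C|%:R^-1 * \prod_s K s (m.2 s)].

Lemma msg_noise_pmf : is_pmf msg_noise.
Proof.
split=> [m|].
  by rewrite ffunE mulr_ge0 ?invr_ge0 ?prodr_ge0 // => s _; case: Ks.
rewrite sum_pair; under eq_bigr do under eq_bigr do rewrite ffunE /=.
under eq_bigr do rewrite -mulr_sumr (sum_ffun_prod1 Ks) mulr1.
by rewrite sumr_const -(mulr_natl _ #|C|) divff // pnatr_eq0 -lt0n.
Qed.

End PrivateSampling.
Arguments msg_noise {R X} C {Y} K.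

(** * Output law of the two-node scheme *)

Section OutputLaw.
Variables (R : realType) (X1 X2 Y1 Y2 C1 C2 : finType) (PX : X1 -> X2 -> R).
Variables (K1 : X1 * (C1 * C2) -> Y1 -> R) (K2 : X2 * (C1 * C2) -> Y2 -> R).
Hypotheses (K1s : stochastic K1) (K2s : stochastic K2).

Let M1 := (C1 * {ffun X1 * (C1 * C2) -> Y1})%type.
Let M2 := (C2 * {ffun X2 * (C1 * C2) -> Y2})%type.

(** Each node reads a single entry of its presampled table, and the other entries integrate to 1.
    Given the sources, the outputs are thus a uniform mixture over message pairs of products of the
    two kernels. *)
Lemma sampled_output_law x1 x2 y1 y2 :
  \sum_(w : X1 * X2 * M1 * M2 |
        (w.1.1.1, w.1.1.2, w.1.2.2 (w.1.1.1, (w.1.2.1, w.2.1)),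
         w.2.2 (w.1.1.2, (w.1.2.1, w.2.1))) == (x1, x2, y1, y2))
    PX w.1.1.1 w.1.1.2 * msg_noise C1 K1 w.1.2 * msg_noise C2 K2 w.2
  = PX x1 x2 * (#|{: C1 * C2}|%:R^-1 *
      \sum_(c : C1 * C2) K1 (x1, c) y1 * K2 (x2, c) y2).
Proof.
rewrite big_mkcond !sum_pair /=.
under [LHS]eq_bigr => a _ do under eq_bigr => b _ do (rewrite sum_pair;
  under eq_bigr => c1 _ do under eq_bigr => m1 _ do rewrite sum_pair /=).
rewrite (bigD1 x1) //= [X in _ + X]big1 ?addr0 => [|a ax]; last first.
  rewrite big1 // => b _; rewrite big1 // => c1 _; rewrite big1 // => m1 _.
  rewrite big1 // => c2 _; rewrite big1 // => m2 _.
  by rewrite !xpair_eqE (negbTE ax).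
rewrite (bigD1 x2) //= [X in _ + X]big1 ?addr0 => [|b bx]; last first.
  rewrite big1 // => c1 _; rewrite big1 // => m1 _.
  rewrite big1 // => c2 _; rewrite big1 // => m2 _.
  by rewrite !xpair_eqE (negbTE bx) andbF.
rewrite mulrA mulr_sumr; apply: eq_bigr => c1 _.
rewrite mulr_sumr exchange_big; apply: eq_bigr => c2 _.
rewrite card_prod natrM invfM.
(* An indicator as test function extracts the law of the one table entry that is read. *)
have e1 := expect_coord (x1, (c1, c2)) (fun y => (y == y1)%:R) K1s.
have e2 := expect_coord (x2, (c1, c2)) (fun y => (y == y2)%:R) K2s.
have sumD (T : finType) (k : T -> R) y : \sum_t k t * (t == y)%:R = k y.
  rewrite (bigD1 y) //= eqxx mulr1 big1 ?addr0 // => t /negbTE ->.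
  by rewrite mulr0.
rewrite !sumD in e1 e2.
transitivity (PX x1 x2 * (#|C1|%:R^-1 / #|C2|%:R) *
  ((\sum_(m : {ffun X1 * (C1 * C2) -> Y1})
      (\prod_i K1 i (m i)) * (m (x1, (c1, c2)) == y1)%:R) *
   (\sum_(m : {ffun X2 * (C1 * C2) -> Y2})
      (\prod_i K2 i (m i)) * (m (x2, (c1, c2)) == y2)%:R))); last first.
  by rewrite e1 e2.
rewrite big_distrlr mulr_sumr; apply: eq_bigr => m1 _.
rewrite mulr_sumr; apply: eq_bigr => m2 _ /=.
rewrite !xpair_eqE !eqxx /= !ffunE /=.
by case: (m1 _ == y1); case: (m2 _ == y2) => /=; ring.
Qed.

End OutputLaw.

Lemma stochastic_prod (R : realType) (I S T : finType) (K : S -> T -> R) :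
  stochastic K ->
  stochastic (fun (s : {ffun I -> S}) (t : {ffun I -> T}) => \prod_i K (s i) (t i)).
Proof.
case=> K0 K1; split=> [s t|s]; first exact: prodr_ge0.
by rewrite (sum_ffun_prod (fun i => K (s i))) big1.
Qed.

(** * The common-source model and its memoryless extension *)

Section CommonSource.
Variables (R : realType) (A B1 B2 F : finType).
Variables (pX : A -> R) (Q : A -> F -> R) (W1 : A * F -> B1 -> R) (W2 : A * F -> B2 -> R).
Hypotheses (pX0 : forall x, 0 <= pX x) (pX1 : \sum_x pX x = 1).
Hypotheses (Qs : stochastic Q) (W1s : stochastic W1) (W2s : stochastic W2).

(** The product form carries the Markov chain: knowing [x] and [f], the nodes can draw their outputs
    separately. *)
Definition chan (x : A) (f : F) (y : B1 * B2) : R := W1 (x, f) y.1 * W2 (x, f) y.2.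

Definition chan_out (x : A) (y : B1 * B2) : R := \sum_f Q x f * chan x f y.

Definition joint (w : A * B1 * B2 * F) : R :=
  pX w.1.1.1 * Q w.1.1.1 w.2 * chan w.1.1.1 w.2 (w.1.1.2, w.1.2).

(** The logarithm of p(y1, y2 | x, f) / p(y1, y2 | x), whose mean under [joint] is the conditional
    mutual information. *)
Definition info_density (w : A * B1 * B2 * F) : R :=
  ln (chan w.1.1.1 w.2 (w.1.1.2, w.1.2) / chan_out w.1.1.1 (w.1.1.2, w.1.2)).

Let Q0 x f : 0 <= Q x f. Proof. by case: Qs. Qed.

Lemma chan_ge0 x f y : 0 <= chan x f y.
Proof. by rewrite mulr_ge0 //; [case: W1s|case: W2s]. Qed.

Lemma chan_sum1 x f : \sum_y chan x f y = 1.
Proof.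
rewrite sum_pair /chan /=.
under eq_bigr do rewrite -mulr_sumr (proj2 W2s) mulr1.
exact: (proj2 W1s).
Qed.

Lemma joint_ge0 w : 0 <= joint w.
Proof. by rewrite mulr_ge0 ?chan_ge0 // mulr_ge0. Qed.

Lemma joint_sum1 : \sum_w joint w = 1.
Proof.
rewrite -pX1 !sum_pair; apply: eq_bigr => x _; rewrite /joint /=.
under eq_bigr do rewrite exchange_big /=.
rewrite exchange_big /=.
under eq_bigr => f _ do
  (under eq_bigr do rewrite -mulr_sumr; rewrite -mulr_sumr).
under eq_bigr => f _ do
  rewrite -(sum_pair (chan x f)) chan_sum1 mulr1.
by rewrite -mulr_sumr (proj2 Qs) mulr1.
Qed.

Section Block.
Variable n : nat.
Local Notation "'V[ T ]" := {ffun 'I_n -> T} (at level 0, format "''V[' T ]").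

Definition chan_n (x : 'V[A]) (f : 'V[F]) (y : 'V[B1] * 'V[B2]) : R :=
  (\prod_i W1 (x i, f i) (y.1 i)) * (\prod_i W2 (x i, f i) (y.2 i)).

Definition Q_n (x : 'V[A]) (f : 'V[F]) : R := \prod_i Q (x i) (f i).

(** The truncation term of the soft covering bound, for the block channel at the source block
    [x]. *)
Definition bad_mass (tau : R) (x : 'V[A]) : R :=
  \sum_(f : 'V[F]) \sum_(y : 'V[B1] * 'V[B2]) Q_n x f *
    (if tau * (\sum_(f' : 'V[F]) Q_n x f' * chan_n x f' y) < chan_n x f y
     then chan_n x f y else 0).

Lemma chan_nE x f y : chan_n x f y = \prod_i chan (x i) (f i) (y.1 i, y.2 i).
Proof. by rewrite /chan_n -big_split. Qed.

Lemma chan_out_nE x y :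
  \sum_(f : 'V[F]) Q_n x f * chan_n x f y
  = \prod_i chan_out (x i) (y.1 i, y.2 i).
Proof.
rewrite /chan_out -(sum_ffun_prod (fun i f => Q (x i) f * chan (x i) f (y.1 i, y.2 i))).
by apply: eq_bigr => f _; rewrite chan_nE -big_split.
Qed.

Lemma chan_n_stochastic x : stochastic (chan_n x).
Proof.
split=> [f y|f].
  by rewrite chan_nE prodr_ge0 // => i _; exact: chan_ge0.
rewrite sum_pair; under eq_bigr do under eq_bigr do rewrite chan_nE /=.
under eq_bigr => y1 _ do
  rewrite (sum_ffun_prod (fun i y2 => chan (x i) (f i) (y1 i, y2))).
rewrite (sum_ffun_prod (fun i y1 => \sum_y2 chan (x i) (f i) (y1, y2))) big1 // => i _.
by rewrite -(sum_pair (chan (x i) (f i))) chan_sum1.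
Qed.

(* Chernoff: on the event [expR (n a) * V^n < W^n] the exponential factors
   below multiply to at least 1. *)
Lemma bad_pointwise (a l : R) (x : 'V[A]) (f : 'V[F]) (y : 'V[B1] * 'V[B2]) : 0 <= l ->
  (\prod_i pX (x i)) * (Q_n x f *
    (if expR (n%:R * a) * (\sum_(f' : 'V[F]) Q_n x f' * chan_n x f' y) < chan_n x f y
     then chan_n x f y else 0))
  <= \prod_i (joint (x i, y.1 i, y.2 i, f i) *
       expR (l * (info_density (x i, y.1 i, y.2 i, f i) - a))).
Proof.
move=> l0; set rhs := (X in _ <= X).
have rhs0 : 0 <= rhs by apply: prodr_ge0 => i _; rewrite mulr_ge0 ?joint_ge0 ?expR_ge0.
case: ifPn => [bad|_]; last by rewrite !mulr0.
have jointE : (\prod_i pX (x i)) * (Q_n x f * chan_n x f y)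
   = \prod_i joint (x i, y.1 i, y.2 i, f i).
  by rewrite chan_nE /Q_n -!big_split /=; apply: eq_bigr => i _; rewrite mulrA.
rewrite jointE.
(* Outside the null case every single-letter factor is positive, so the logarithms in the
   information densities are genuine. *)
have [j0|jn0] := eqVneq (\prod_i joint (x i, y.1 i, y.2 i, f i)) 0.
  by rewrite j0.
have jp i : 0 < joint (x i, y.1 i, y.2 i, f i).
  rewrite lt_def joint_ge0 andbT; apply: contraNneq jn0 => ji.
  by rewrite (bigD1 i) //= ji mul0r.
have -> : rhs = (\prod_i joint (x i, y.1 i, y.2 i, f i)) *
    \prod_i expR (l * (info_density (x i, y.1 i, y.2 i, f i) - a)).
  by rewrite -big_split.
apply: ler_peMr; first by apply: prodr_ge0 => i _; exact: joint_ge0.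
rewrite -expR_sum -expR0 ler_expR -mulr_sumr mulr_ge0 //.
have Wp i : 0 < chan (x i) (f i) (y.1 i, y.2 i).
  rewrite lt_def chan_ge0 andbT; apply: contraTneq (jp i) => e.
  by rewrite /joint /= e mulr0 ltxx.
have Qp i : 0 < Q (x i) (f i).
  rewrite lt_def Q0 andbT; apply: contraTneq (jp i) => e.
  by rewrite /joint /= e mulr0 mul0r ltxx.
have Vp i : 0 < chan_out (x i) (y.1 i, y.2 i).
  rewrite /chan_out (bigD1 (f i)) //=; apply: ltr_pwDl; first exact: mulr_gt0.
  by apply: sumr_ge0 => g _; rewrite mulr_ge0 ?chan_ge0.
rewrite big_split /= sumr_const card_ord -mulr_natl mulrN subr_ge0.
rewrite -ler_expR expR_sum.
(* The exponentiated densities multiply to the block likelihood ratio, which [bad] bounds from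
   below. *)
have -> : \prod_i expR (info_density (x i, y.1 i, y.2 i, f i))
   = chan_n x f y / \prod_i chan_out (x i) (y.1 i, y.2 i).
  rewrite chan_nE -prodf_div; apply: eq_bigr => i _.
  by rewrite /info_density /= lnK // posrE; apply: divr_gt0; [exact: Wp|exact: Vp].
rewrite ler_pdivlMr ?prodr_gt0 // -chan_out_nE; exact: ltW.
Qed.

(** Summed over all sequences, the pointwise product bound factors into [n] copies of one
    single-letter exponential moment. *)
Lemma bad_mass_le (a l : R) : 0 <= l ->
  \sum_(x : 'V[A]) (\prod_i pX (x i)) * bad_mass (expR (n%:R * a)) x
  <= (\sum_w joint w * expR (l * (info_density w - a))) ^+ n.
Proof.
move=> l0; pose phi w := joint w * expR (l * (info_density w - a)).
apply: (@le_trans _ _ (\sum_(x : 'V[A]) \sum_(f : 'V[F])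
   \sum_(y1 : 'V[B1]) \sum_(y2 : 'V[B2]) \prod_i phi (x i, y1 i, y2 i, f i))).
  apply: ler_sum => x _; rewrite /bad_mass mulr_sumr; apply: ler_sum => f _.
  rewrite sum_pair mulr_sumr; apply: ler_sum => y1 _.
  rewrite mulr_sumr; apply: ler_sum => y2 _.
  exact: bad_pointwise.
under eq_bigr => x _ do under eq_bigr => f _ do
  under eq_bigr => y1 _ do
    rewrite (sum_ffun_prod (fun i y2 => phi (x i, y1 i, y2, f i))).
under eq_bigr => x _ do under eq_bigr => f _ do
  rewrite (sum_ffun_prod (fun i y1 => \sum_y2 phi (x i, y1, y2, f i))).
rewrite (sum_ffun_prod2 _ (fun x f => \sum_y1 \sum_y2 phi (x, y1, y2, f))).
rewrite prodr_const card_ord !sum_pair.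
rewrite (_ : \sum_s _ = \sum_x \sum_s \sum_t \sum_f phi (x, s, t, f)) //.
apply: eq_bigr => x _; rewrite exchange_big; apply: eq_bigr => y1 _.
by rewrite exchange_big.
Qed.

End Block.

(** * Construction of the two-round code and its asymptotics *)

Section Codes.
Variable q : {ffun A * A * B1 * B2 -> R}.
Hypotheses (qdiag : forall x1 x2 y1 y2, x1 != x2 -> q (x1, x2, y1, y2) = 0)
  (qfac : forall x y1 y2, q (x, x, y1, y2) = pX x * chan_out x (y1, y2)).

Lemma chan_out_sum1 x : \sum_y chan_out x y = 1.
Proof.
rewrite exchange_big /=; under eq_bigr do rewrite -mulr_sumr chan_sum1 mulr1.
exact: (proj2 Qs).
Qed.

Lemma qXE x1 x2 : qX q x1 x2 = if x1 == x2 then pX x1 else 0.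
Proof.
rewrite /qX; case: eqVneq => [<-|x12]; last first.
  by rewrite big1 // => y1 _; rewrite big1 // => y2 _; rewrite qdiag.
under eq_bigr do under eq_bigr do rewrite qfac.
under eq_bigr do rewrite -mulr_sumr.
by rewrite -mulr_sumr -(sum_pair (chan_out x1)) chan_out_sum1 mulr1.
Qed.

Lemma prod_qX_ge0 n (x1 x2 : {ffun 'I_n -> A}) : 0 <= \prod_i qX q (x1 i) (x2 i).
Proof. by apply: prodr_ge0 => i _; rewrite qXE; case: ifP. Qed.

Lemma code_space_pmf n (M1 M2 : finType) (pM1 : {ffun M1 -> R}) (pM2 : {ffun M2 -> R}) :
  is_pmf pM1 -> is_pmf pM2 -> is_pmf (code_space q n pM1 pM2).
Proof.
move=> [M10 M11] [M20 M21]; split=> [w|].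
  by rewrite ffunE !mulr_ge0 // prod_qX_ge0.
rewrite !sum_pair.
under eq_bigr => x1 _ do under eq_bigr => x2 _ do
  (under eq_bigr => m1 _ do
    (under eq_bigr => m2 _ do rewrite ffunE /=; rewrite -mulr_sumr M21 mulr1);
   rewrite -mulr_sumr M11 mulr1).
rewrite (sum_ffun_prod2 _ (qX q)) big1 // => i _; rewrite -pX1.
apply: eq_bigr => x _; rewrite (bigD1 x) //= qXE eqxx big1 ?addr0 // => x' xx'.
by rewrite qXE eq_sym (negbTE xx').
Qed.

(** The rates follow from the sizes of the message sets. The distance is the average over source
    blocks of the soft covering error, each block having its own codebook. *)
Lemma block_code n (L1 L2 : nat) (R12 R21 a sigma eps : R) :
  (0 < n)%N -> (0 < L1)%N -> (0 < L2)%N ->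
  ln L1%:R <= n%:R * R12 -> ln L2%:R <= n%:R * R21 ->
  0 < sigma -> expR (n%:R * a) / (L1 * L2)%:R <= sigma ^+ 2 ->
  2 * (\sum_(x : {ffun 'I_n -> A}) (\prod_i pX (x i)) * bad_mass (expR (n%:R * a)) x)
    + sigma <= eps ->
  code2_exists q n R12 R21 eps.
Proof.
move=> n0 L10 L20 lnL1 lnL2 s0 tau_s le_eps.
pose tau := expR (n%:R * a); rewrite -/tau in tau_s le_eps.
pose V (T : finType) : finType := {ffun 'I_n -> T}.
pose C : finType := ('I_L1 * 'I_L2)%type.
have cardC : #|{: C}| = (L1 * L2)%N by rewrite card_prod !card_ord.
have Qns (x : V A) : stochastic (fun _ : C => Q_n x).
  by split=> [_ f|_]; [exact: (proj1 (stochastic_prod _ Qs))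
                      |exact: (proj2 (stochastic_prod _ Qs))].
have cover (x : V A) : exists c : {ffun C -> V F},
    \sum_y `|#|{: C}|%:R^-1 * (\sum_i chan_n x (c i) y)
             - \sum_(f : V F) Q_n x f * chan_n x f y|
    <= 2 * bad_mass tau x + sigma.
  apply: (soft_covering (Qns x) _ (chan_n_stochastic x)) => //.
  - by move=> f; apply: prodr_ge0.
  - by rewrite cardC muln_gt0 L10.
  - exact: expR_ge0.
  - by rewrite cardC.
(* Both nodes observe [x] and, after two rounds, know the index in [C]; they therefore agree on the
   codeword. *)
pose cb x : {ffun C -> V F} := projT1 (cid (cover x)).
have cbP x := projT2 (cid (cover x)); rewrite -/(cb _) in cbP.
pose K1 (s : V A * C) (y : V B1) : R := \prod_i W1 (s.1 i, cb s.1 s.2 i) (y i).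
pose K2 (s : V A * C) (y : V B2) : R := \prod_i W2 (s.1 i, cb s.1 s.2 i) (y i).
have K1s : stochastic K1.
  split=> [s y|s]; first by apply: prodr_ge0 => i _; exact: (proj1 W1s).
  rewrite (sum_ffun_prod (fun i => W1 (s.1 i, cb s.1 s.2 i))) big1 // => i _.
  exact: (proj2 W1s).
have K2s : stochastic K2.
  split=> [s y|s]; first by apply: prodr_ge0 => i _; exact: (proj1 W2s).
  rewrite (sum_ffun_prod (fun i => W2 (s.1 i, cb s.1 s.2 i))) big1 // => i _.
  exact: (proj2 W2s).
have N1 : is_pmf (msg_noise 'I_L1 K1) by apply: msg_noise_pmf; rewrite ?card_ord.
have N2 : is_pmf (msg_noise 'I_L2 K2) by apply: msg_noise_pmf; rewrite ?card_ord.
have Ppmf := code_space_pmf n N1 N2.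
exists ('I_L1 * {ffun V A * C -> V B1})%type, ('I_L2 * {ffun V A * C -> V B2})%type.
exists 'I_L1, 'I_L2, (msg_noise 'I_L1 K1), (msg_noise 'I_L2 K2).
(* Each message is the uniform component of the private noise, so it depends neither on the source
   nor on the other message. *)
exists (fun _ m => m.1), (fun _ _ m => m.1).
exists (fun x (m : 'I_L1 * {ffun V A * C -> V B1}) c1 c2 => m.2 (x, (c1, c2))).
exists (fun x (m : 'I_L2 * {ffun V A * C -> V B2}) c1 c2 => m.2 (x, (c1, c2))).
split=> //; split=> // P c1 c2 out.
have rate (T : finType) (c : V A * V A * _ * _ -> T) (r : R) :
    ln #|T|%:R <= n%:R * r -> Hrv P c / n%:R <= r.
  move=> Hr; rewrite ler_pdivrMr ?ltr0n // mulrC.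
  exact: le_trans (entropy_le_ln_card (dlaw_pmf c Ppmf)) Hr.
split; [by apply: rate; rewrite card_ord | by apply: rate; rewrite card_ord |].
apply: le_trans le_eps.
have outE x1 x2 y1 y2 : dlaw P out (x1, x2, y1, y2) =
    (\prod_i qX q (x1 i) (x2 i)) * (#|{: C}|%:R^-1 *
      \sum_(c : C) K1 (x1, c) y1 * K2 (x2, c) y2).
  rewrite -(sampled_output_law (fun a b : V A => \prod_i qX q (a i) (b i)) K1s K2s).
  by rewrite ffunE; apply: eq_bigr => w _; rewrite ffunE.
rewrite /l1dist !sum_pair.
apply: (@le_trans _ _ (\sum_(x : V A) (\prod_i pX (x i)) * (2 * bad_mass tau x + sigma))).
  apply: ler_sum => x _.
  (* Pairs of distinct source blocks have mass 0 under both laws, by a coordinate where they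
     differ. *)
  rewrite (bigD1 x) //= [X in _ + X]big1 ?addr0 => [|x' xx']; last first.
    have [i xi] : exists i, x i != x' i.
      apply: contrapT => /forallNP H; move/negP: xx'; apply; apply/eqP/ffunP => i.
      by have /negP/negPn/eqP := H i.
    rewrite big1 // => y1 _; rewrite big1 // => y2 _.
    rewrite outE ffunE /= (bigD1 i) //= qXE (negbTE xi) !mul0r.
    by rewrite (bigD1 i) //= qdiag // mul0r subrr normr0.
  have PX0 : 0 <= \prod_i pX (x i) by exact: prodr_ge0.
  apply: le_trans (ler_wpM2l PX0 (cbP x)).
  rewrite mulr_sumr sum_pair; apply: ler_sum => y1 _; apply: ler_sum => y2 _.
  rewrite outE ffunE /=.
  have -> : \prod_i qX q (x i) (x i) = \prod_i pX (x i).
    by apply: eq_bigr => i _; rewrite qXE eqxx.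
  have -> : \prod_i q (x i, x i, y1 i, y2 i) = (\prod_i pX (x i)) *
      \sum_(f : V F) Q_n x f * chan_n x f (y1, y2).
    rewrite chan_out_nE -big_split; apply: eq_bigr => i _ /=; exact: qfac.
  by rewrite -mulrBr normrM (ger0_norm PX0).
under eq_bigr do rewrite mulrDr.
have PX1 : \sum_(x : V A) \prod_i pX (x i) = 1.
  by rewrite (sum_ffun_prod (fun _ : 'I_n => pX)) big1.
rewrite big_split /= -mulr_suml PX1 mul1r lerD2r mulr_sumr.
by apply: ler_sum => x _; rewrite mulrCA.
Qed.

(** Rounding [expR r] down to an integer [L >= 1] loses at most a factor 2, because
    [expR r < L + 1 <= 2 * L]. *)
Lemma exists_message_set (r : R) : 0 <= r ->
  exists L : nat, [/\ (0 < L)%N, ln L%:R <= r & expR r <= 2 * L%:R].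
Proof.
move=> r0; exists (Num.trunc (expR r)).
have e1 : 1 <= expR r by rewrite -expR0 ler_expR.
have L0 : (0 < Num.trunc (expR r))%N by rewrite truncn_gt0.
split=> //.
  rewrite -[leRHS]expRK ler_ln ?posrE ?expR_gt0 ?ltr0n //.
  by rewrite truncn_le expR_ge0.
have := truncnS_gt (expR r); rewrite -natr1.
have : 1 <= (Num.trunc (expR r))%:R :> R by rewrite ler1n.
lra.
Qed.

Lemma soft_covering_admissible (R12 R21 : R) : 0 <= R12 -> 0 <= R21 ->
  \sum_w joint w * info_density w < R12 + R21 ->
  admissible2 q R12 R21.
Proof.
move=> R120 R210; set I := \sum_w _ => IR eps eps0.
(* The threshold exponent [a] is the midpoint of [I] and [R12 + R21]: being above [I] it makes the
   bad mass decay, being below the sum rate it makes [tau] small against the codebook size. *)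
pose d := (R12 + R21 - I) / 2; pose a := I + d.
have d0 : 0 < d by rewrite /d divr_gt0 ?subr_gt0.
have Ia : I < a by rewrite /a ltrDl.
have [l l0 cl1] := exp_moment_lt1 joint_ge0 joint_sum1 Ia.
set c := \sum_t _ in cl1.
have c0 : 0 <= c by apply: sumr_ge0 => w _; rewrite mulr_ge0 ?joint_ge0 ?expR_ge0.
(* Error budget: twice a bad mass of [eps / 4], plus [sigma = eps / 2]. *)
have e4 : 0 < eps / 4 by rewrite divr_gt0.
have [n1 Hn1] := pow_le_eventually c0 cl1 e4.
have s0 : 0 < eps / 2 by rewrite divr_gt0.
(* The divisor 4 pays for the factor 2 lost in rounding each of the two message sets. *)
have e16 : 0 < (eps / 2) ^+ 2 / 4 by rewrite divr_gt0 ?exprn_gt0.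
have ed1 : expR (- d) < 1 by rewrite -expR0 ltr_expR oppr_lt0.
have [n2 Hn2] := pow_le_eventually (expR_ge0 _) ed1 e16.
exists (maxn 1 (maxn n1 n2)) => n; rewrite !geq_max => /and3P[n0 nn1 nn2].
have [L1 [L10 lnL1 L1e]] := exists_message_set (mulr_ge0 (ler0n R n) R120).
have [L2 [L20 lnL2 L2e]] := exists_message_set (mulr_ge0 (ler0n R n) R210).
apply: (@block_code n L1 L2 R12 R21 a (eps / 2) eps) => //.
  rewrite ler_pdivrMr ?ltr0n ?muln_gt0 ?L10 //.
  have -> : n%:R * a = n%:R * (- d) + (n%:R * R12 + n%:R * R21).
    by rewrite /a /d; field.
  rewrite 2!expRD (expRM_natl n (- d)).
  apply: (@le_trans _ _ ((eps / 2) ^+ 2 / 4 * ((2 * L1%:R) * (2 * L2%:R)))).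
    apply: ler_pM; [by rewrite exprn_ge0 ?expR_ge0| |exact: Hn2|].
      by rewrite mulr_ge0 ?expR_ge0.
    by apply: ler_pM; rewrite ?expR_ge0.
  by rewrite natrM le_eqVlt; apply/orP; left; apply/eqP; field.
have := bad_mass_le n a (ltW l0); rewrite -/c.
have := Hn1 n nn1; move: (c ^+ n) => z; move: (\sum_x _) => y.
lra.
Qed.

End Codes.
End CommonSource.

(** * From the Markov chain to kernels and mutual information *)

Section SingleLetter.
Variables (R : realType) (A B1 B2 F : finType).
Variable p : {ffun A * B1 * B2 * F -> R}.

(** The kernels are the conditional laws of [F] given [X] and of each output given [F] and [X]; the
    Markov identity, divided by the mass of [(f, x)], gives the product form. *)
Lemma markov_factorization : is_pmf p ->
  markov_chain p (fun w => w.1.1.2) (fun w => (w.2, w.1.1.1)) (fun w => w.1.2) ->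
  exists (Q : A -> F -> R) (W1 : A * F -> B1 -> R) (W2 : A * F -> B2 -> R),
    [/\ stochastic Q, stochastic W1, stochastic W2
      & forall w, p w = joint (dlaw p (fun w => w.1.1.1)) Q W1 W2 w].
Proof.
move=> [p0 p1] mc.
(* A sample point supplies the default values of the kernels on null conditioning events. *)
have [w0 _] : exists w : A * B1 * B2 * F, (0 : R) <= 0.
  apply: (@expect_le_exists R _ p (fun=> 0)) => //.
  by rewrite big1 // => w _; rewrite mulr0.
have d0 (T : finType) (X : A * B1 * B2 * F -> T) t : 0 <= dlaw p X t.
  by rewrite ffunE sumr_ge0.
have [Q [Qs Qf]] := @conditional_kernel R A F
  (fun x f => dlaw p (fun w => (w.2, w.1.1.1)) (f, x)) w0.2 (fun _ _ => d0 _ _ _).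
have [W1 [W1s W1f]] := @conditional_kernel R (A * F)%type B1
  (fun s y => dlaw p (fun w => (w.1.1.2, (w.2, w.1.1.1))) (y, (s.2, s.1)))
  w0.1.1.2 (fun _ _ => d0 _ _ _).
have [W2 [W2s W2f]] := @conditional_kernel R (A * F)%type B2
  (fun s y => dlaw p (fun w => (w.1.2, (w.2, w.1.1.1))) (y, (s.2, s.1)))
  w0.1.2 (fun _ _ => d0 _ _ _).
exists Q, W1, W2; split=> // -[[[x y1] y2] f].
have {}Qf := Qf x f; have {}W1f := W1f (x, f) y1; have {}W2f := W2f (x, f) y2.
rewrite dlaw_marginal in Qf; rewrite dlaw_marginal /= in W1f.
rewrite dlaw_marginal /= in W2f.
have := mc y1 y2 (f, x); rewrite W1f W2f.
have -> : dlaw p (fun w => (w.1.1.2, w.1.2, (w.2, w.1.1.1))) (y1, y2, (f, x))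
   = p (x, y1, y2, f).
  rewrite ffunE (big_pred1 (x, y1, y2, f)) // => -[[[x' y1'] y2'] f'] /=.
  rewrite !xpair_eqE.
  by case: (x' == x); case: (y1' == y1); case: (y2' == y2); case: (f' == f).
rewrite /joint /chan /= -Qf.
set s := dlaw _ _ (f, x) => e.
(* Division by [s] is impossible when it is 0, but then it dominates [p (x, y1, y2, f)], which also
   vanishes. *)
have [s0|sn0] := eqVneq s 0.
  rewrite s0 mul0r; apply/eqP; rewrite eq_le p0 andbT -s0.
  exact: (ler_dlaw (fun w => (w.2, w.1.1.1)) (x, y1, y2, f) p0).
by apply: (mulIf sn0); rewrite e; ring.
Qed.

Section Factored.
Variables (pX : A -> R) (Q : A -> F -> R) (W1 : A * F -> B1 -> R) (W2 : A * F -> B2 -> R).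
Hypotheses (W1s : stochastic W1) (W2s : stochastic W2).
Hypothesis (pE : forall w, p w = joint pX Q W1 W2 w).
Variables (G : finType) (h : F -> G).
Hypothesis h_inj : injective h.

(** The auxiliary variable is seen through an injective encoding [h], so that the result applies to
    the tagged form in which the rate conditions present it. *)
Lemma dlaw_joint x y1 y2 f :
  dlaw p (fun w => (w.1.1.2, w.1.2, (h w.2, w.1.1.1))) (y1, y2, (h f, x))
  = pX x * Q x f * chan W1 W2 x f (y1, y2).
Proof.
rewrite -[RHS]/(joint pX Q W1 W2 (x, y1, y2, f)) -pE.
rewrite ffunE (big_pred1 (x, y1, y2, f)) // => -[[[x' y1'] y2'] f'] /=.
rewrite !xpair_eqE (inj_eq h_inj).
by case: (x' == x); case: (y1' == y1); case: (y2' == y2); case: (f' == f).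
Qed.

Lemma dlaw_source_codeword x f :
  dlaw p (fun w => (h w.2, w.1.1.1)) (h f, x) = pX x * Q x f.
Proof.
rewrite -(dlaw_marginal p (fun w => (w.1.1.2, w.1.2))).
under eq_bigr => y _ do rewrite [y]surjective_pairing dlaw_joint -surjective_pairing.
by rewrite -mulr_sumr (chan_sum1 W1s W2s) mulr1.
Qed.

Lemma dlaw_output_source x y1 y2 :
  dlaw p (fun w => (w.1.1.2, w.1.2, w.1.1.1)) (y1, y2, x)
  = pX x * chan_out Q W1 W2 x (y1, y2).
Proof.
rewrite -(dlaw_marginal p (fun w => w.2)) mulr_sumr; apply: eq_bigr => f _.
rewrite mulrA -dlaw_joint; apply: dlaw_reindex => w.
rewrite !xpair_eqE (inj_eq h_inj).
by case: (w.1.1.1 == _); case: (w.1.1.2 == _); case: (w.1.2 == _); case: (w.2 == _).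
Qed.

End Factored.

Lemma dlaw_source (pX : A -> R) Q W1 W2 x :
  stochastic Q -> stochastic W1 -> stochastic W2 ->
  (forall w, p w = joint pX Q W1 W2 w) ->
  dlaw p (fun w => w.1.1.1) x = pX x.
Proof.
move=> Qs W1s W2s pE; rewrite -(dlaw_marginal p (fun w => w.2)).
under eq_bigr => f _ do rewrite (dlaw_source_codeword W1s W2s pE (@inj_id F)).
by rewrite -mulr_sumr (proj2 Qs) mulr1.
Qed.

(** In the logarithmic form of the conditional mutual information the factors [pX x] and [Q x f]
    cancel, leaving the ratio of [chan] to [chan_out]. *)
Lemma cmi_info_density (pX : A -> R) Q W1 W2 (G : finType) (h : F -> G) :
  stochastic Q -> stochastic W1 -> stochastic W2 -> (forall x, 0 <= pX x) ->
  (forall w, p w = joint pX Q W1 W2 w) -> injective h ->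
  cmi p (fun w => (w.1.1.2, w.1.2)) (fun w => h w.2) (fun w => w.1.1.1)
  = \sum_w joint pX Q W1 W2 w * info_density Q W1 W2 w.
Proof.
move=> Qs W1s W2s pX0 pE h_inj; rewrite cmiE; apply: eq_bigr => -[[[x y1] y2] f] _.
(* Outcomes of mass 0 contribute nothing; elsewhere all factors are positive and the logarithms
   split. *)
rewrite -pE /=; have [->|pn0] := eqVneq (p (x, y1, y2, f)) 0; first by rewrite !mul0r.
congr (_ * _); rewrite /info_density /=.
rewrite (dlaw_source _ Qs W1s W2s pE) (dlaw_output_source pE h_inj).
rewrite (dlaw_source_codeword W1s W2s pE h_inj).
have -> : dlaw p (fun w => (w.1.1.2, w.1.2, h w.2, w.1.1.1)) (y1, y2, h f, x)
    = pX x * Q x f * chan W1 W2 x f (y1, y2).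
  rewrite -(dlaw_joint pE h_inj); apply: dlaw_reindex => w.
  by rewrite !xpair_eqE !andbA.
rewrite pE /joint /= in pn0.
have xp : 0 < pX x.
  by rewrite lt_def pX0 andbT; apply: contraNneq pn0 => ->; rewrite !mul0r.
have qp : 0 < Q x f.
  by rewrite lt_def (proj1 Qs) andbT; apply: contraNneq pn0 => ->; rewrite mulr0 mul0r.
have wp : 0 < chan W1 W2 x f (y1, y2).
  by rewrite lt_def chan_ge0 // andbT; apply: contraNneq pn0 => ->; rewrite mulr0.
have vp : 0 < chan_out Q W1 W2 x (y1, y2).
  rewrite /chan_out (bigD1 f) //=; apply: ltr_pwDl; first exact: mulr_gt0.
  by apply: sumr_ge0 => g _; rewrite mulr_ge0 ?chan_ge0 //; exact: (proj1 Qs).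
move: xp qp wp vp {pn0}; move: (chan_out _ _ _ _ _) (chan _ _ _ _ _) => v c xp qp cp vp.
by rewrite ln_div ?posrE // !lnM ?posrE ?mulr_gt0 //; ring.
Qed.

End SingleLetter.

(** * Admissibility from the rate conditions *)

Theorem theorem4 (R : realType) (A B1 B2 : finType)
  (q : {ffun A * A * B1 * B2 -> R})
  (r : nat) (Fa : 'I_r -> finType)
  (p : {ffun A * B1 * B2 * {dffun forall i : 'I_r, Fa i} -> R})
  (Rp : 'I_r -> R) :
  is_pmf q ->
  (forall x1 x2 y1 y2, x1 != x2 -> q (x1, x2, y1, y2) = 0) ->
  (1 <= r)%N ->
  is_pmf p ->
  (forall x y1 y2,
     dlaw p (fun w => (w.1.1.1, w.1.1.2, w.1.2)) (x, y1, y2) = q (x, x, y1, y2)) ->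
  markov_chain p (fun w => w.1.1.2) (fun w => (w.2, w.1.1.1)) (fun w => w.1.2) ->
  (forall i, 0 < Rp i) ->
  (forall s : nat, (1 <= s <= r)%N ->
     cmi p (fun w => (w.1.1.2, w.1.2))
           (fun w => [ffun i : 'I_r =>
                        if (i < s)%N then Some (Tagged Fa (w.2 i)) else None])
           (fun w => w.1.1.1)
     < \sum_(i : 'I_r | (i < s)%N) Rp i) ->
  admissible2 q (\sum_(i : 'I_r | odd i.+1) Rp i) (\sum_(i : 'I_r | ~~ odd i.+1) Rp i).
Proof.
move=> _ qdiag r1 p_pmf pq mc Rp0 rates.
have [Q [W1 [W2 [Qs W1s W2s pE]]]] := markov_factorization p_pmf mc.
set pX := dlaw p _ in pE.
have [pX0 pX1] : is_pmf pX by exact: dlaw_pmf.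
have qfac x y1 y2 : q (x, x, y1, y2) = pX x * chan_out Q W1 W2 x (y1, y2).
  rewrite -pq -(dlaw_output_source pE (@inj_id _)); apply: dlaw_reindex => w.
  by rewrite !xpair_eqE -andbA andbC.
apply: (soft_covering_admissible pX0 pX1 Qs W1s W2s qdiag qfac).
- by apply: sumr_ge0 => i _; exact: ltW.
- by apply: sumr_ge0 => i _; exact: ltW.
(* This is the encoding in the rate condition at [s = r]; every index lies below [r], so no
   component is erased and [h] is injective. *)
pose h (f : {dffun forall i : 'I_r, Fa i}) : {ffun 'I_r -> option {i : 'I_r & Fa i}} :=
  [ffun i : 'I_r => if (i < r)%N then Some (Tagged Fa (f i)) else None].
have h_inj : injective h.
  move=> f g /ffunP fg; apply/ffunP => i.
  have := fg i; rewrite !ffunE ltn_ord => -[] /eqP.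
  by rewrite eq_Tagged => /eqP.
rewrite -(cmi_info_density Qs W1s W2s pX0 pE h_inj).
(* Index [i] counts from 0 and stands for round [i.+1]; odd and even rounds together give the full
   sum rate. *)
have -> : \sum_(i < r | odd i.+1) Rp i + \sum_(i < r | ~~ odd i.+1) Rp i
   = \sum_(i : 'I_r | (i < r)%N) Rp i.
  rewrite [RHS](bigID (fun i : 'I_r => odd i.+1)) /=.
  by congr (_ + _); apply: eq_bigl => i; rewrite ltn_ord.
by apply: rates; rewrite r1 leqnn.
Qed.
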